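(* Let $G$ be a finite nilpotent group. The clone of congruence preserving functions of $G$ is finitely generated if and only if for every Sylow subgroup $S$ of $G$, the clone of congruence preserving functions of the group $S$ is finitely generated.
   Context: For a group $H$, a function $f:H^k\to H$ is congruence preserving if for all $(g_1,\dots,g_k),(h_1,\dots,h_k)\in H^k$ the element $f(g_1,\dots,g_k)^{-1}f(h_1,\dots,h_k)$ lies in the normal subgroup of $H$ generated by $\{g_1^{-1}h_1,\dots,g_k^{-1}h_k\}$ (equivalently, $f$ preserves every congruence of $H$). The congruence preserving functions of all arities $k\ge1$ form a clone on $H$ (a set of finitary operations containing all projections and closed under composition); it is finitely generated if it has a finite subset $F$ such that each of its members is a composition of projections and functions in $F$. *)

(* Defs.v *)
From HB Require Import structures.
From mathcomp Require Import all_boot all_fingroup all_solvable.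

Set Implicit Arguments.
Unset Strict Implicit.
Unset Printing Implicit Defensive.

Local Open Scope group_scope.

(* [operation A k] is the type of (k+1)-ary operations on A: the successor    *)
(* makes all arities positive.                                                *)
Definition operation (A : finType) (k : nat) := {ffun k.+1.-tuple A -> A}.

Definition projection (A : finType) (k : nat) (i : 'I_k.+1) : operation A k :=
  [ffun x : k.+1.-tuple A => tnth x i].

Definition composition (A : finType) (n k : nat) (f : operation A n)
    (g : 'I_n.+1 -> operation A k) : operation A k :=
  [ffun x : k.+1.-tuple A => f [tuple g i x | i < n.+1]].

Definition is_clone (A : finType) (C : forall k, operation A k -> Prop) : Prop :=
  (forall (k : nat) (i : 'I_k.+1), C k (projection A i)) /\
  (forall (n k : nat) (f : operation A n) (g : 'I_n.+1 -> operation A k),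
     C n f -> (forall i, C k (g i)) -> C k (composition f g)).

Inductive generated_clone (A : finType) (F : seq {k : nat & operation A k}) :
    forall k : nat, operation A k -> Prop :=
  | GenProjection (k : nat) (i : 'I_k.+1) :
      generated_clone F (projection A i)
  | GenGenerator (k : nat) (f : operation A k) :
      Tagged (operation A) f \in F -> generated_clone F f
  | GenComposition (n k : nat) (f : operation A n)
        (g : 'I_n.+1 -> operation A k) :
      generated_clone F f -> (forall i, generated_clone F (g i)) ->
      generated_clone F (composition f g).

Definition finitely_generated (A : finType)
    (C : forall k, operation A k -> Prop) : Prop :=
  exists F : seq {k : nat & operation A k},
    (forall (k : nat) (f : operation A k),
       Tagged (operation A) f \in F -> C k f) /\
    (forall (k : nat) (f : operation A k), C k f -> generated_clone F f).

Definition normal_closure (H : finGroupType) (X : {set H}) : {set H} :=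
  \bigcap_(N : {group H} | (N <| [set: H]) && (X \subset N)) N.

Definition congruence_preserving (H : finGroupType) (k : nat)
    (f : operation H k) : Prop :=
  forall g h : k.+1.-tuple H,
    (f g)^-1 * f h \in
      normal_closure [set (tnth g i)^-1 * tnth h i | i : 'I_k.+1].

Lemma normal_closureE (H : finGroupType) (X : {set H}) :
  normal_closure X = <<class_support X [set: H]>>.
Proof.
apply/eqP; rewrite eqEsubset; apply/andP; split.
  apply: (bigcap_inf [group of <<class_support X [set: H]>>]).
  rewrite /normal subsetT norms_gen ?class_support_norm //=.
  exact: subset_trans (sub_class_support _ _) (subset_gen _).
apply/bigcapsP => N /andP[nN sXN].
by rewrite gen_subG class_support_sub_norm // normal_norm.
Qed.

Lemma congruence_preserving_clone (H : finGroupType) :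
  is_clone (@congruence_preserving H).
Proof.
split=> [k i g h | n k f g Cf Cg x y].
  apply/bigcapP => N /andP[_ /subsetP sXN].
  by rewrite !ffunE; apply/sXN/imsetP; exists i.
rewrite !ffunE; apply/bigcapP => N /andP[nN sXN].
have/bigcapP := Cf [tuple g i x | i < n.+1] [tuple g i y | i < n.+1].
apply; rewrite nN; apply/subsetP => _ /imsetP[i _ ->]; rewrite !tnth_mktuple.
by have/bigcapP := Cg i x y; apply; rewrite nN.
Qed.

(* Main.v *)
Require Import Defs.
From HB Require Import structures.
From mathcomp Require Import all_boot all_fingroup all_solvable.

Set Implicit Arguments.
Unset Strict Implicit.
Unset Printing Implicit Defensive.

Local Open Scope group_scope.

(** A finite nilpotent group [G] is the direct product of its Sylow subgroups,
    and its normal subgroups are the products of normal subgroups of the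
    factors, so congruence preserving functions of [G] are the tuples of
    congruence preserving functions of the factors.

    Fix a Sylow subgroup [S], the projection [pi] of [G] onto [S] and the
    inclusion [iota] of [S] into [G].  A congruence preserving [f] on [G]
    respects the kernel of [pi], so the [S]-component of [f x] depends only on
    the [S]-components of [x] ([retract_factor]): passing to the [S]-component
    is a clone homomorphism.  It is onto, because a congruence preserving
    function of [S], made trivial on the other factors, is congruence preserving
    on [G] ([extend_congruence_preserving]): a normal subgroup of [G] contains
    the [S]-components of its elements, these being powers of the elements.
    Images of generators are generators, and the clone of [S] is finitely
    generated as soon as that of [G] is ([finitely_generated_retract]).

    Conversely, generators of the clone of [S], made trivial on the other
    factors, together with the unary projection [iota \o pi], generate all the
    functions [iota \o pi \o f] ([retract_components_generated]).  As every
    element of [G] is the product of its Sylow components, adjoining these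
    finite sets for all primes and the binary multiplication of [G] generates
    every [f] ([components_generated_mul]). *)

(** * Clones *)

Lemma congruence_preservingP (H : finGroupType) k (f : operation H k) :
  congruence_preserving f <->
  forall (N : {group H}) (g h : k.+1.-tuple H), N <| [set: H] ->
    (forall i, (tnth g i)^-1 * tnth h i \in N) -> (f g)^-1 * f h \in N.
Proof.
split=> [Cf N g h nN gh | Cf g h].
  have /bigcapP := Cf g h; apply; rewrite nN.
  by apply/subsetP=> _ /imsetP[i _ ->].
apply/bigcapP=> N /andP[nN /subsetP sN]; apply: Cf => // i.
by apply/sN/imsetP; exists i.
Qed.

(** Lists of generators compare operations of different arities as dependent
    pairs; transporting along such an equality avoids inverting it. *)
Lemma eq_congruence_preserving (H : finGroupType) k n
    (f : operation H k) (g : operation H n) :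
    Tagged (operation H) f = Tagged (operation H) g ->
  congruence_preserving g -> congruence_preserving f.
Proof.
move=> eq_fg.
suff: congruence_preserving (tagged (Tagged (operation H) g)) ->
  congruence_preserving f by [].
by rewrite -eq_fg.
Qed.

Lemma generated_clone_min (A : finType) (C : forall k, operation A k -> Prop)
    (F : seq {k : nat & operation A k}) :
    is_clone C ->
    (forall k (f : operation A k), Tagged (operation A) f \in F -> C k f) ->
  forall k (f : operation A k), generated_clone F f -> C k f.
Proof.
by move=> [Cproj Ccomp] CF k f; elim=> *; [apply: Cproj|apply: CF|apply: Ccomp].
Qed.

Lemma generated_clone_sub (A : finType) (F E : seq {k : nat & operation A k}) :
    {subset F <= E} ->
  forall k (f : operation A k), generated_clone F f -> generated_clone E f.
Proof.
move=> sFE; apply: generated_clone_min => [|k f /sFE]; last exact: GenGenerator.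
by split; [apply: GenProjection | apply: GenComposition].
Qed.

(** * Retracts *)

Section Retract.

Variables (H K : finGroupType).
Variables (pi : {morphism [set: H] >-> K}) (iota : {morphism [set: K] >-> H}).

Definition restrict k (f : operation H k) : operation K k :=
  [ffun y : k.+1.-tuple K => pi (f (map_tuple iota y))].

Definition extend k (f : operation K k) : operation H k :=
  [ffun x : k.+1.-tuple H => iota (f (map_tuple pi x))].

Hypothesis iotaK : cancel iota pi.

Lemma retract_surjective : pi @* [set: H] = [set: K].
Proof.
apply/setP=> y; rewrite inE; apply/morphimP.
by exists (iota y); rewrite ?inE ?iotaK.
Qed.

Lemma extendK k : cancel (@extend k) (@restrict k).
Proof.
move=> f; apply/ffunP=> y; rewrite !ffunE iotaK; congr (f _).
by apply: eq_from_tnth => i; rewrite !tnth_map iotaK.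
Qed.

Lemma restrict_projection k (i : 'I_k.+1) :
  restrict (projection H i) = projection K i.
Proof. by apply/ffunP=> y; rewrite !ffunE tnth_map iotaK. Qed.

Lemma extend_composition n k (f : operation K n)
    (g : 'I_n.+1 -> operation K k) :
  extend (composition f g) = composition (extend f) (fun i => extend (g i)).
Proof.
apply/ffunP=> x; rewrite !ffunE; congr (iota (f _)).
by apply: eq_from_tnth => i; rewrite !(tnth_map, tnth_ord_tuple) ffunE iotaK.
Qed.

(** The arguments [x] and [iota (pi x)] are congruent modulo the kernel of
    [pi], hence so are their images under [f]. *)
Lemma retract_factor k (f : operation H k) (x : k.+1.-tuple H) :
  congruence_preserving f -> pi (f x) = restrict f (map_tuple pi x).
Proof.
move=> /congruence_preservingP Cf; rewrite ffunE.
set y := map_tuple iota _.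
suff: (f x)^-1 * f y \in 'ker pi.
  move/mker/eqP; rewrite morphM ?morphV ?inE // -eq_mulVg1; exact: eqP.
apply: Cf => [|i]; first exact: ker_normal.
apply/kerP; rewrite ?inE // morphM ?morphV ?inE //.
by rewrite !tnth_map iotaK mulVg.
Qed.

Lemma restrict_composition n k (f : operation H n)
    (g : 'I_n.+1 -> operation H k) :
    congruence_preserving f ->
  restrict (composition f g) =
    composition (restrict f) (fun i => restrict (g i)).
Proof.
move=> Cf; apply/ffunP=> y; rewrite !ffunE retract_factor // ffunE.
congr (pi (f _)); apply: eq_from_tnth => i.
by rewrite !(tnth_map, tnth_ord_tuple) ffunE.
Qed.

Lemma restrict_congruence_preserving k (f : operation H k) :
  congruence_preserving f -> congruence_preserving (restrict f).
Proof.
move=> /congruence_preservingP Cf; apply/congruence_preservingP=> N g h nN gh.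
have -> : (restrict f g)^-1 * restrict f h =
    pi ((f (map_tuple iota g))^-1 * f (map_tuple iota h)).
  by rewrite !ffunE morphM ?morphV ?inE.
have preN z : (z \in pi @*^-1 N) = (pi z \in N).
  by rewrite morphpreE !inE.
rewrite -preN; apply: Cf => [|i].
  have := nN; rewrite -(morphpre_normal (f := pi)) ?retract_surjective ?subsetT //.
  by rewrite morphpreT.
by rewrite preN morphM ?morphV ?inE // !tnth_map !iotaK.
Qed.

Hypothesis retract_normal : forall N : {group H},
  N <| [set: H] -> {in N, forall x, iota (pi x) \in N}.

(** Congruence modulo [N] maps to congruence modulo the normal subgroup
    [pi @* N], and [iota] sends [pi @* N] back into [N]. *)
Lemma extend_congruence_preserving k (f : operation K k) :
  congruence_preserving f -> congruence_preserving (extend f).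
Proof.
move=> /congruence_preservingP Cf; apply/congruence_preservingP=> N g h nN gh.
rewrite !ffunE -morphV ?inE // -morphM ?inE //.
have: (f (map_tuple pi g))^-1 * f (map_tuple pi h) \in pi @* N.
  apply: Cf => [|i].
    by rewrite -retract_surjective morphim_normal.
  by rewrite !tnth_map -morphV ?inE // -morphM ?inE // mem_morphim ?inE.
by case/morphimP=> u _ Nu ->; apply: retract_normal.
Qed.

(** Restriction is compatible with composition by [retract_factor] and onto by
    [extendK], so the restrictions of generators are generators. *)
Lemma finitely_generated_retract :
  finitely_generated (@congruence_preserving H) ->
  finitely_generated (@congruence_preserving K).
Proof.
case=> F [CF genF].
pose rF := [seq Tagged (operation K) (restrict (tagged t)) | t <- F].
have restrict_gen k (f : operation H k) :
  generated_clone F f -> generated_clone rF (restrict f).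
- elim=> {k f} [k i | k f Ff | n k f g genf IHf _ IHg].
  + by rewrite restrict_projection; apply: GenProjection.
  + by apply/GenGenerator/mapP; exists (Tagged (operation H) f).
  rewrite restrict_composition; first exact: GenComposition.
  exact: generated_clone_min (congruence_preserving_clone H) CF _ _ genf.
exists rF; split=> [k f /mapP[[n g] Fg eq_fg] | k f Cf].
  apply: (eq_congruence_preserving eq_fg).
  exact/restrict_congruence_preserving/CF.
by rewrite -(extendK f); apply/restrict_gen/genF/extend_congruence_preserving.
Qed.

End Retract.

(** * Components *)

(** For [e] the projection onto a direct factor, this says that the congruence
    preserving functions trivial on the other factors lie in one finitely
    generated clone of congruence preserving functions; for [e] the identity it is finite
    generation of the whole clone.  The property is stable under pointwise
    products in [e], which lets the factors be added one by one. *)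
Definition components_generated (H : finGroupType) (e : H -> H) : Prop :=
  exists F : seq {k : nat & operation H k},
    (forall k (f : operation H k),
       Tagged (operation H) f \in F -> congruence_preserving f) /\
    (forall k (f : operation H k), congruence_preserving f ->
       generated_clone F ([ffun x => e (f x)] : operation H k)).

Lemma components_generated_id (H : finGroupType) (e : H -> H) :
  e =1 id -> components_generated e ->
  finitely_generated (@congruence_preserving H).
Proof.
move=> e_id [F [CF genF]]; exists F; split=> // k f /genF.
by congr generated_clone; apply/ffunP=> x; rewrite ffunE e_id.
Qed.

Lemma components_generated_eq (H : finGroupType) (e1 e2 : H -> H) :
  e1 =1 e2 -> components_generated e1 -> components_generated e2.
Proof.
move=> e12 [F [CF genF]]; exists F; split=> // k f /genF.
by congr generated_clone; apply/ffunP=> x; rewrite !ffunE e12.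
Qed.

Lemma components_generated1 (H : finGroupType) :
  components_generated (fun _ : H => 1).
Proof.
pose c : operation H 0 := [ffun=> 1].
exists [:: Tagged (operation H) c]; split=> [k f | k f _].
  rewrite inE => /eqP eq_fc; apply: (eq_congruence_preserving eq_fc).
  by apply/congruence_preservingP=> N g h _ _; rewrite !ffunE mulVg group1.
have -> : [ffun x => 1] = composition c (fun _ => projection H (@ord0 k)).
  by apply/ffunP=> x; rewrite !ffunE.
by apply: GenComposition => [|i]; [apply/GenGenerator/mem_head|apply: GenProjection].
Qed.

Definition mul_operation (H : finGroupType) : operation H 1 :=
  [ffun x : 2.-tuple H => tnth x ord0 * tnth x ord_max].

Lemma mul_congruence_preserving (H : finGroupType) :
  congruence_preserving (mul_operation H).
Proof.
apply/congruence_preservingP=> N g h nN gh; rewrite !ffunE.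
set a := tnth g _; set b := tnth g _; set c := tnth h _; set d := tnth h _.
have -> : (a * b)^-1 * (c * d) = (a^-1 * c) ^ b * (b^-1 * d).
  by rewrite /conjg invMg !mulgA mulgK.
rewrite groupM ?gh // memJ_norm ?gh //.
by apply: (subsetP (normal_norm nN)); rewrite inE.
Qed.

Lemma components_generated_mul (H : finGroupType) (e1 e2 : H -> H) :
  components_generated e1 -> components_generated e2 ->
  components_generated (fun x => e1 x * e2 x).
Proof.
move=> [F1 [CF1 genF1]] [F2 [CF2 genF2]].
exists (Tagged (operation H) (mul_operation H) :: F1 ++ F2).
split=> [k f | k f Cf].
  rewrite inE mem_cat => /orP[/eqP eq_f | /orP[/CF1|/CF2]] //.
  exact: (eq_congruence_preserving eq_f) (@mul_congruence_preserving H).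
pose g (i : 'I_2) : operation H k :=
  if i == ord0 then [ffun x => e1 (f x)] else [ffun x => e2 (f x)].
have -> : [ffun x => e1 (f x) * e2 (f x)] = composition (mul_operation H) g.
  by apply/ffunP=> x; rewrite !ffunE !tnth_mktuple /g /= !ffunE.
apply: GenComposition => [|i]; first exact/GenGenerator/mem_head.
rewrite /g; case: ifP => _; [have := genF1 _ _ Cf | have := genF2 _ _ Cf];
  by apply: generated_clone_sub => t Ft; rewrite inE mem_cat Ft ?orbT.
Qed.

(** The function [iota \o pi \o f] is the extension of the restriction of [f].
    Extension turns compositions into compositions, but sends the projections
    to [iota \o pi] of the projections; hence the extra unary generator. *)
Lemma retract_components_generated (H K : finGroupType)
    (pi : {morphism [set: H] >-> K}) (iota : {morphism [set: K] >-> H}) :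
    cancel iota pi ->
    (forall N : {group H},
       N <| [set: H] -> {in N, forall x, iota (pi x) \in N}) ->
    finitely_generated (@congruence_preserving K) ->
  components_generated (fun x => iota (pi x)).
Proof.
move=> iotaK pi_normal [F [CF genF]].
pose e := extend pi iota (projection K (@ord0 0)).
pose eF := Tagged (operation H) e ::
  [seq Tagged (operation H) (extend pi iota (tagged t)) | t <- F].
have extend_gen k (f : operation K k) :
  generated_clone F f -> generated_clone eF (extend pi iota f).
- elim=> {k f} [k i | k f Ff | n k f g _ IHf _ IHg].
  + have -> : extend pi iota (projection K i) =
        composition e (fun _ => projection H i).
      by apply/ffunP=> x; rewrite !(ffunE, tnth_map, tnth_ord_tuple).
    apply: GenComposition => [|_]; last exact: GenProjection.
    exact/GenGenerator/mem_head.
  + apply/GenGenerator; rewrite inE; apply/orP; right; apply/mapP.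
    by exists (Tagged (operation K) f).
  by rewrite extend_composition //; apply: GenComposition.
exists eF; split=> [k f | k f Cf].
  rewrite inE => /orP[/eqP eq_f | /mapP[[n g] Fg eq_f]].
    apply: (eq_congruence_preserving eq_f); apply: extend_congruence_preserving => //.
    exact: (congruence_preserving_clone K).1.
  apply: (eq_congruence_preserving eq_f).
  exact/extend_congruence_preserving/CF.
have -> : [ffun x => iota (pi (f x))] = extend pi iota (restrict pi iota f).
  by apply/ffunP=> x; rewrite [LHS]ffunE [RHS]ffunE (retract_factor iotaK).
exact/extend_gen/genF/restrict_congruence_preserving.
Qed.

(** * Sylow components of a nilpotent group *)

Lemma constt_pcore (gT : finGroupType) (G : {group gT}) (rho : nat_pred) x :
  nilpotent G -> x \in G -> x.`_rho \in 'O_rho(G).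
Proof.
move=> nilG Gx; have hallO := nilpotent_pcore_Hall rho nilG.
by rewrite (mem_normal_Hall hallO) ?pcore_normal ?p_elt_constt ?groupX.
Qed.

(** In a nilpotent group the [rho]-parts and the [rho^']-parts lie in two
    subgroups that centralise each other, so the product of the parts of [x] and
    [y] is the decomposition of [x * y]. *)
Lemma nilpotent_consttM (gT : finGroupType) (G : {group gT}) (rho : nat_pred) :
  nilpotent G -> {in G &, {morph (fun x => x.`_rho) : x y / x * y}}.
Proof.
move=> nilG x y Gx Gy.
have [_ _ cO _] := dprodP (nilpotent_pcoreC rho nilG).
have comm u v : u \in 'O_rho(G) -> v \in 'O_rho^'(G) -> commute u v.
  by move=> Ou Ov; apply/commute_sym/(centsP cO).
have inO sigma := constt_pcore sigma nilG.
have Oxy : x.`_rho * y.`_rho \in 'O_rho(G) by rewrite groupM ?inO.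
have Oxy' : x.`_rho^' * y.`_rho^' \in 'O_rho^'(G) by rewrite groupM ?inO.
have -> : x * y = (x.`_rho * y.`_rho) * (x.`_rho^' * y.`_rho^').
  rewrite -{1}(consttC rho x) -{1}(consttC rho y) -!mulgA; congr (_ * _).
  by rewrite !mulgA (comm y.`_rho x.`_rho^') ?inO.
rewrite (consttM _ (comm _ _ Oxy Oxy')).
rewrite (constt_p_elt (mem_p_elt (pcore_pgroup _ _) Oxy)).
by rewrite (constt1P (mem_p_elt (pcore_pgroup _ _) Oxy')) mulg1.
Qed.

Lemma constt_nonprime (gT : finGroupType) (x : gT) p : ~~ prime p -> x.`_p = 1.
Proof.
move=> p_npr; apply/constt1P/pnatP=> // q q_pr _; rewrite !inE.
by apply: contraNneq p_npr => <-.
Qed.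

Lemma prod_constt_bound (gT : finGroupType) (x : gT) n :
  #[x] <= n -> \prod_(0 <= p < n.+1) x.`_p = x.
Proof.
move=> le_xn; rewrite (big_cat_nat (n := #[x].+1)) //= prod_constt.
rewrite big_nat big1 ?mulg1 // => p /andP[lt_xp _].
apply/constt1P/pnatP=> // q _ /(dvdn_leq (order_gt0 x)) le_qx.
by rewrite !inE neq_ltn (leq_ltn_trans le_qx).
Qed.

Section SylowRetract.

Variables (gT : finGroupType) (G S : {group gT}) (p : nat).
Hypotheses (nilG : nilpotent G) (sylS : p.-Sylow(G) S).

Lemma constt_Sylow x : x \in G -> x.`_p \in S.
Proof. by rewrite (nilpotent_Hall_pcore nilG sylS); apply: constt_pcore. Qed.

Definition Sylow_proj (x : [subg G]) : [subg S] := subg S (sgval x).`_p.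

Definition Sylow_incl (y : [subg S]) : [subg G] := subg G (sgval y).

Lemma Sylow_projM : {in [set: [subg G]] &, {morph Sylow_proj : x y / x * y}}.
Proof.
move=> x y _ _; apply: val_inj; rewrite /= !subgK ?constt_Sylow ?groupM ?subgP //.
by rewrite (nilpotent_consttM _ nilG) ?subgP.
Qed.

Lemma Sylow_inclM : {in [set: [subg S]] &, {morph Sylow_incl : x y / x * y}}.
Proof.
have sSG := subsetP (pHall_sub sylS).
by move=> x y _ _; apply: val_inj; rewrite /= !subgK ?sSG ?groupM ?subgP.
Qed.

Lemma Sylow_inclK : cancel Sylow_incl Sylow_proj.
Proof.
have sSG := subsetP (pHall_sub sylS).
move=> y; apply: val_inj; rewrite /= subgK ?constt_Sylow ?subgP ?sSG ?subgP //.
rewrite subgK ?sSG ?subgP //.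
by rewrite constt_p_elt // (mem_p_elt (pHall_pgroup sylS)) ?subgP.
Qed.

Lemma Sylow_incl_proj x : Sylow_incl (Sylow_proj x) = x.`_p.
Proof.
apply: val_inj.
by rewrite /= !subgK ?morph_constt ?constt_Sylow ?groupX ?subgP ?inE.
Qed.

Lemma Sylow_retract_normal (N : {group [subg G]}) :
  N <| [set: [subg G]] -> {in N, forall x, Sylow_incl (Sylow_proj x) \in N}.
Proof. by move=> _ x Nx; rewrite Sylow_incl_proj groupX. Qed.

End SylowRetract.

(** * Reduction to the Sylow subgroups *)

Local Close Scope group_scope.

Theorem theorem2p3 (gT : finGroupType) (G : {group gT}) (nilG : nilpotent G) :
  finitely_generated (@congruence_preserving [subg G]) <->
  (forall (p : nat) (S : {group gT}), prime p -> (p.-Sylow(G) S)%g ->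
     finitely_generated (@congruence_preserving [subg S])).
Proof.
split=> [fgG p S _ sylS | fgS].
  apply: (finitely_generated_retract (pi := Morphism (Sylow_projM nilG sylS))
    (iota := Morphism (Sylow_inclM sylS))) fgG.
    exact: Sylow_inclK.
  exact: Sylow_retract_normal.
(* Only prime indices contribute to these products; ranging over all integers
   up to the group order makes them amenable to induction on the bound. *)
pose e n (x : subg_of G) := (\prod_(0 <= p < n) x.`_p)%g.
apply: (@components_generated_id _ (e #|subg_of G|.+1)).
  by move=> x; rewrite /e prod_constt_bound // max_card.
elim: #|subg_of G|.+1 => [|p IHp].
  apply: (components_generated_eq _ (components_generated1 _)) => x.
  by rewrite /e big_geq.
have: components_generated (fun x : subg_of G => x.`_p)%g.
  have [p_pr | p_npr] := boolP (prime p); last first.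
    apply: (components_generated_eq _ (components_generated1 _)) => x.
    by rewrite constt_nonprime.
  have sylS := nilpotent_pcore_Hall p nilG.
  have := retract_components_generated (pi := Morphism (Sylow_projM nilG sylS))
    (iota := Morphism (Sylow_inclM sylS)) (Sylow_inclK nilG sylS)
    (Sylow_retract_normal nilG sylS) (fgS _ _ p_pr sylS).
  by apply: components_generated_eq => x; rewrite /= Sylow_incl_proj.
move/(components_generated_mul IHp).
by apply: components_generated_eq => x; rewrite /e big_nat_recr.
Qed.
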